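(* The following categories are equivalent: (1) the category of continuous domains and open filter morphisms; (2) the category of bicontinuous bi-dcpos and Galois morphisms between them; (3) the category of bicontinuous embedded bi-dcpos and embedded Galois morphisms between them.
   Context: Directed: nonempty and every two elements have an upper bound in the set; codirected is the order dual. A dcpo is a poset with all directed joins. In a dcpo $D$, $u$ is way below $v$ if for every directed $E\subseteq D$ with $v\le\bigvee E$ there is $e\in E$ with $u\le e$. A continuous domain is a dcpo in which, for every $u$, the set of elements way below $u$ is directed with supremum $u$. A Scott-open filter of $D$ is a codirected (in particular nonempty) upset $F$ such that every directed $I\subseteq D$ with $\bigvee I\in F$ meets $F$. An open filter morphism $f\colon D_1\to D_2$ is a function such that the preimage under $f$ of every Scott-open filter of $D_2$ is a Scott-open filter of $D_1$. Polarity: a triple $(\mathcal K,\mathcal O,\vartriangleleft)$ of two sets and a relation $\vartriangleleft$ from $\mathcal K$ to $\mathcal O$. Put ${\uparrow_{\mathcal O}}k=\{u\in\mathcal O\mid k\vartriangleleft u\}$, ${\downarrow_{\mathcal K}}u=\{k\in\mathcal K\mid k\vartriangleleft u\}$. Specialization preorders: $k\le l$ iff ${\uparrow_{\mathcal O}}k\supseteq{\uparrow_{\mathcal O}}l$; $u\le v$ iff ${\downarrow_{\mathcal K}}u\subseteq{\downarrow_{\mathcal K}}v$. The polarity is purified if both are partial orders. Put ${\downarrow_{\mathcal K}}k=\{l\in\mathcal K\mid l\le k\}$. Bi-dcpo: a purified polarity such that, in the specialization orders, $\mathcal K$ has all codirected meets and $\mathcal O$ all directed joins; if $k\vartriangleleft\bigvee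 I$ with $k\in\mathcal K$ and $I\subseteq\mathcal O$ directed, then $k\vartriangleleft u$ for some $u\in I$; and if $\bigwedge F\vartriangleleft u$ with $u\in\mathcal O$ and $F\subseteq\mathcal K$ codirected, then $k\vartriangleleft u$ for some $k\in F$. For $u\in\mathcal O$, $k\in\mathcal K$ write $u\blacktriangleleft k$ iff ${\downarrow_{\mathcal K}}u\subseteq{\downarrow_{\mathcal K}}k$. The bi-dcpo is locally compact if $k\vartriangleleft u$ implies that there are $u'\in\mathcal O$, $k'\in\mathcal K$ with $k\vartriangleleft u'\blacktriangleleft k'\vartriangleleft u$; it is bicontinuous if it is locally compact, ${\downarrow_{\mathcal K}}u$ is directed for every $u\in\mathcal O$, and ${\uparrow_{\mathcal O}}k$ is codirected for every $k\in\mathcal K$. Galois morphism from $(\mathcal K_1,\mathcal O_1,\vartriangleleft_1)$ to $(\mathcal K_2,\mathcal O_2,\vartriangleleft_2)$: a pair of functions $(\varphi\colon\mathcal K_1\to\mathcal K_2,\ \Box\colon\mathcal O_2\to\mathcal O_1)$ such that $\varphi(k)\vartriangleleft_2u\iff k\vartriangleleft_1\Box(u)$ for all $k\in\mathcal K_1$, $u\in\mathcal O_2$. Composition is componentwise. Double base lattice: $(L,\mathcal K,\mathcal O)$ with $L$ a complete lattice, $\mathcal K,\mathcal O\subseteq L$, every element of $L$ being a join of elements of $\mathcal K$ and a meet of elements of $\mathcal O$. Embedded bi-dcpo: a double base lattice such that $\mathcal K$ is closed in $L$ under codirected meets and $\mathcal O$ under directed joins; $k\le\bigvee I$ with $k\in\mathcal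 K$, $I\subseteq\mathcal O$ directed implies $k\le u$ for some $u\in I$; and $\bigwedge F\le u$ with $u\in\mathcal O$, $F\subseteq\mathcal K$ codirected implies $k\le u$ for some $k\in F$. It is locally compact if for $k\in\mathcal K$, $u\in\mathcal O$ with $k\le u$ there are $u'\in\mathcal O$, $k'\in\mathcal K$ with $k\le u'\le k'\le u$; it is bicontinuous if moreover $\{k\in\mathcal K\mid k\le u\}$ is directed for every $u\in\mathcal O$ and $\{u\in\mathcal O\mid k\le u\}$ is codirected for every $k\in\mathcal K$. Embedded Galois morphism from $(L_1,\mathcal K_1,\mathcal O_1)$ to $(L_2,\mathcal K_2,\mathcal O_2)$: a pair $(\varphi\colon L_1\to L_2,\ \Box\colon L_2\to L_1)$ with $\varphi(x)\le y\iff x\le\Box(y)$ for all $x\in L_1,y\in L_2$, with $\varphi[\mathcal K_1]\subseteq\mathcal K_2$ and $\Box[\mathcal O_2]\subseteq\mathcal O_1$. Composition is componentwise. The axiom of (dependent) choice is assumed. *)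

(* Defs.v *)
From Stdlib Require Import Relation_Definitions.
From mathcomp Require Import all_boot boolp classical_sets.

Set Implicit Arguments.
Unset Strict Implicit.
Unset Printing Implicit Defensive.

Local Open Scope classical_set_scope.

(* Orders are [Prop]-valued relations on bare types (Stdlib's [relation] and
   [order]) rather than [porderType]s, because the orders of a polarity are
   derived from its relation. *)

Definition converse T (le : relation T) : relation T := fun x y => le y x.

Definition directed T (le : relation T) (A : set T) : Prop :=
  A !=set0 /\
  forall x y, A x -> A y -> exists z, [/\ A z, le x z & le y z].

Definition codirected T (le : relation T) (A : set T) : Prop :=
  directed (converse le) A.

Definition is_join T (le : relation T) (A : set T) (j : T) : Prop :=
  (forall x, A x -> le x j) /\
  (forall y, (forall x, A x -> le x y) -> le j y).

Definition is_meet T (le : relation T) (A : set T) (m : T) : Prop :=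
  is_join (converse le) A m.

Definition is_complete_lattice T (le : relation T) : Prop :=
  [/\ Relation_Definitions.order T le,
      forall A, exists j, is_join le A j
    & forall A, exists m, is_meet le A m].

(** Continuous domains *)

Definition is_dcpo T (le : relation T) : Prop :=
  Relation_Definitions.order T le /\ forall E, directed le E -> exists j, is_join le E j.

Definition way_below T (le : relation T) (u v : T) : Prop :=
  forall E j, directed le E -> is_join le E j -> le v j ->
    exists2 e, E e & le u e.

Definition is_continuous_domain T (le : relation T) : Prop :=
  is_dcpo le /\
  forall u, directed le [set v | way_below le v u] /\
            is_join le [set v | way_below le v u] u.

Definition scott_open_filter T (le : relation T) (F : set T) : Prop :=
  [/\ codirected le F,
      forall x y, F x -> le x y -> F y
    & forall I j, directed le I -> is_join le I j -> F j -> I `&` F !=set0].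

Record continuous_domain := ContinuousDomain {
  cd_sort :> Type;
  cd_le : relation cd_sort;
  cd_axiom : is_continuous_domain cd_le }.

Record open_filter_morphism (D1 D2 : continuous_domain) := OpenFilterMorphism {
  ofm_fun :> D1 -> D2;
  ofm_axiom : forall F, scott_open_filter (@cd_le D2) F ->
    scott_open_filter (@cd_le D1) (ofm_fun @^-1` F) }.

(** Polarities and bi-dcpos *)

Record polarity := Polarity {
  pol_K : Type;
  pol_O : Type;
  pol_rel : pol_K -> pol_O -> Prop }.

Definition upO (P : polarity) (k : pol_K P) : set (pol_O P) :=
  [set u | pol_rel k u].

Definition downK (P : polarity) (u : pol_O P) : set (pol_K P) :=
  [set k | pol_rel k u].

Definition leK (P : polarity) : relation (pol_K P) :=
  fun k l => upO l `<=` upO k.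

Definition leO (P : polarity) : relation (pol_O P) :=
  fun u v => downK u `<=` downK v.

Definition purified (P : polarity) : Prop :=
  Relation_Definitions.order (pol_K P) (@leK P) /\
  Relation_Definitions.order (pol_O P) (@leO P).

Definition downKK (P : polarity) (k : pol_K P) : set (pol_K P) :=
  [set l | leK l k].

Definition black_rel (P : polarity) (u : pol_O P) (k : pol_K P) : Prop :=
  downK u `<=` downKK k.

Record is_bidcpo (P : polarity) : Prop := IsBidcpo {
  bd_purified : purified P;
  bd_meets : forall F, codirected (@leK P) F -> exists m, is_meet (@leK P) F m;
  bd_joins : forall I, directed (@leO P) I -> exists j, is_join (@leO P) I j;
  bd_compact : forall (k : pol_K P) I j,
    directed (@leO P) I -> is_join (@leO P) I j -> pol_rel k j ->
    exists2 u, I u & pol_rel k u;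
  bd_cocompact : forall (u : pol_O P) F m,
    codirected (@leK P) F -> is_meet (@leK P) F m -> pol_rel m u ->
    exists2 k, F k & pol_rel k u }.

Definition locally_compact (P : polarity) : Prop :=
  forall (k : pol_K P) (u : pol_O P), pol_rel k u ->
    exists u' k', [/\ pol_rel k u', black_rel u' k' & pol_rel k' u].

Definition bicontinuous (P : polarity) : Prop :=
  [/\ locally_compact P,
      forall u : pol_O P, directed (@leK P) (downK u)
    & forall k : pol_K P, codirected (@leO P) (upO k)].

Record bicontinuous_bidcpo := BicontinuousBidcpo {
  bb_polarity :> polarity;
  bb_bidcpo : is_bidcpo bb_polarity;
  bb_bicontinuous : bicontinuous bb_polarity }.

Record galois_morphism (P1 P2 : polarity) := GaloisMorphism {
  gm_phi : pol_K P1 -> pol_K P2;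
  gm_box : pol_O P2 -> pol_O P1;
  gm_axiom : forall k u, pol_rel (gm_phi k) u <-> pol_rel k (gm_box u) }.

(** Double base lattices and embedded bi-dcpos *)

Record double_base_lattice := DoubleBaseLattice {
  db_sort :> Type;
  db_le : relation db_sort;
  db_K : set db_sort;
  db_O : set db_sort;
  db_complete : is_complete_lattice db_le;
  db_join_base : forall x, exists2 A, A `<=` db_K & is_join db_le A x;
  db_meet_base : forall x, exists2 A, A `<=` db_O & is_meet db_le A x }.

Record is_embedded_bidcpo (L : double_base_lattice) : Prop :=
  IsEmbeddedBidcpo {
  ebd_meets : forall F m, F `<=` @db_K L -> codirected (@db_le L) F ->
    is_meet (@db_le L) F m -> db_K m;
  ebd_joins : forall I j, I `<=` @db_O L -> directed (@db_le L) I ->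
    is_join (@db_le L) I j -> db_O j;
  ebd_compact : forall k I j, @db_K L k -> I `<=` @db_O L ->
    directed (@db_le L) I -> is_join (@db_le L) I j -> db_le k j ->
    exists2 u, I u & db_le k u;
  ebd_cocompact : forall u F m, @db_O L u -> F `<=` @db_K L ->
    codirected (@db_le L) F -> is_meet (@db_le L) F m -> db_le m u ->
    exists2 k, F k & db_le k u }.

Definition embedded_locally_compact (L : double_base_lattice) : Prop :=
  forall k u : L, db_K k -> db_O u -> db_le k u ->
    exists u' k', [/\ db_O u', db_K k', db_le k u', db_le u' k' & db_le k' u].

Definition embedded_bicontinuous (L : double_base_lattice) : Prop :=
  [/\ embedded_locally_compact L,
      forall u : L, db_O u ->
        directed (@db_le L) [set k | db_K k /\ db_le k u]
    & forall k : L, db_K k ->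
        codirected (@db_le L) [set u | db_O u /\ db_le k u]].

Record bicontinuous_embedded_bidcpo := BicontinuousEmbeddedBidcpo {
  beb_lattice :> double_base_lattice;
  beb_bidcpo : is_embedded_bidcpo beb_lattice;
  beb_bicontinuous : embedded_bicontinuous beb_lattice }.

Record embedded_galois_morphism (L1 L2 : double_base_lattice) :=
  EmbeddedGaloisMorphism {
  egm_phi : L1 -> L2;
  egm_box : L2 -> L1;
  egm_adj : forall x y, db_le (egm_phi x) y <-> db_le x (egm_box y);
  egm_K : egm_phi @` @db_K L1 `<=` @db_K L2;
  egm_O : egm_box @` @db_O L2 `<=` @db_O L1 }.

(** Categories and their equivalence *)

Record category := Category {
  ob :> Type;
  hom : ob -> ob -> Type;
  idm : forall a, hom a a;
  cmp : forall a b c, hom b c -> hom a b -> hom a c;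
  cmp_idl : forall a b (f : hom a b), cmp (idm b) f = f;
  cmp_idr : forall a b (f : hom a b), cmp f (idm a) = f;
  cmp_assoc : forall a b c d (h : hom c d) (g : hom b c) (f : hom a b),
    cmp h (cmp g f) = cmp (cmp h g) f }.

Record functor (C D : category) := Functor {
  fob :> C -> D;
  fmap : forall a b, hom a b -> hom (fob a) (fob b);
  fmap_id : forall a, fmap (idm a) = idm (fob a);
  fmap_cmp : forall a b c (g : hom b c) (f : hom a b),
    fmap (cmp g f) = cmp (fmap g) (fmap f) }.

Definition functor_id (C : category) : functor C C :=
  @Functor C C id (fun _ _ f => f) (fun _ => erefl) (fun _ _ _ _ _ => erefl).

Lemma functor_comp_id C D E (G : functor D E) (F : functor C D) (a : C) :
  fmap G (fmap F (idm a)) = idm (G (F a)).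
Proof. by rewrite !fmap_id. Qed.

Lemma functor_comp_cmp C D E (G : functor D E) (F : functor C D)
    (a b c : C) (g : hom b c) (f : hom a b) :
  fmap G (fmap F (cmp g f)) = cmp (fmap G (fmap F g)) (fmap G (fmap F f)).
Proof. by rewrite !fmap_cmp. Qed.

Definition functor_comp C D E (G : functor D E) (F : functor C D) :
    functor C E :=
  @Functor C E (fun a => G (F a)) (fun _ _ f => fmap G (fmap F f))
    (functor_comp_id G F) (functor_comp_cmp G F).

Definition naturally_isomorphic C D (F G : functor C D) : Prop :=
  exists (eta : forall a : C, hom (F a) (G a))
         (eps : forall a : C, hom (G a) (F a)),
    [/\ forall (a b : C) (f : hom a b),
          cmp (eta b) (fmap F f) = cmp (fmap G f) (eta a),
        forall a, cmp (eps a) (eta a) = idm (F a)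
      & forall a, cmp (eta a) (eps a) = idm (G a)].

Definition equivalent_categories (C D : category) : Prop :=
  exists (F : functor C D) (G : functor D C),
    naturally_isomorphic (functor_comp G F) (functor_id C) /\
    naturally_isomorphic (functor_comp F G) (functor_id D).

(** The three categories *)

Lemma ofm_ext D1 D2 (f g : open_filter_morphism D1 D2) :
  ofm_fun f = ofm_fun g -> f = g.
Proof.
by case: f g => [f Hf] [g Hg] /= e; subst g; rewrite (Prop_irrelevance Hf Hg).
Qed.

Definition ofm_id (D : continuous_domain) : open_filter_morphism D D :=
  @OpenFilterMorphism D D id (fun _ HF => HF).

Definition ofm_comp (D1 D2 D3 : continuous_domain)
    (g : open_filter_morphism D2 D3) (f : open_filter_morphism D1 D2) :
    open_filter_morphism D1 D3 :=
  @OpenFilterMorphism D1 D3 (fun x => g (f x))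
    (fun _ HF => ofm_axiom f (ofm_axiom g HF)).

Definition continuous_domain_cat : category.
Proof.
by refine (@Category continuous_domain open_filter_morphism ofm_id ofm_comp
  _ _ _) => *; apply: ofm_ext.
Defined.

Lemma gm_ext P1 P2 (f g : galois_morphism P1 P2) :
  gm_phi f = gm_phi g -> gm_box f = gm_box g -> f = g.
Proof.
case: f g => [f f' Hf] [g g' Hg] /= e e'; subst g g'.
by rewrite (Prop_irrelevance Hf Hg).
Qed.

Definition gm_id (P : polarity) : galois_morphism P P :=
  @GaloisMorphism P P id id (fun _ _ => iff_refl _).

Definition gm_comp (P1 P2 P3 : polarity)
    (g : galois_morphism P2 P3) (f : galois_morphism P1 P2) :
    galois_morphism P1 P3 :=
  @GaloisMorphism P1 P3
    (fun k => gm_phi g (gm_phi f k)) (fun u => gm_box f (gm_box g u))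
    (fun k u => iff_trans (gm_axiom g _ _) (gm_axiom f _ _)).

Definition bicontinuous_bidcpo_cat : category.
Proof.
by refine (@Category bicontinuous_bidcpo (fun P1 P2 => galois_morphism P1 P2)
  (fun P => gm_id P) (fun _ _ _ g f => gm_comp g f) _ _ _)
  => *; apply: gm_ext.
Defined.

Lemma egm_ext L1 L2 (f g : embedded_galois_morphism L1 L2) :
  egm_phi f = egm_phi g -> egm_box f = egm_box g -> f = g.
Proof.
case: f g => [f f' H1 H2 H3] [g g' H1' H2' H3'] /= e e'; subst g g'.
by rewrite (Prop_irrelevance H1 H1') (Prop_irrelevance H2 H2')
  (Prop_irrelevance H3 H3').
Qed.

Definition egm_id (L : double_base_lattice) : embedded_galois_morphism L L.
Proof.
refine (@EmbeddedGaloisMorphism L L id id (fun _ _ => iff_refl _) _ _).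
- by move=> _ [x Kx <-].
- by move=> _ [x Ox <-].
Defined.

Definition egm_comp (L1 L2 L3 : double_base_lattice)
    (g : embedded_galois_morphism L2 L3) (f : embedded_galois_morphism L1 L2) :
    embedded_galois_morphism L1 L3.
Proof.
refine (@EmbeddedGaloisMorphism L1 L3
  (fun x => egm_phi g (egm_phi f x)) (fun y => egm_box f (egm_box g y))
  (fun x y => iff_trans (egm_adj g _ _) (egm_adj f _ _)) _ _).
- move=> _ [x Kx <-]; apply: (egm_K (e := g)); exists (egm_phi f x) => //.
  by apply: (egm_K (e := f)); exists x.
- move=> _ [y Oy <-]; apply: (egm_O (e := f)); exists (egm_box g y) => //.
  by apply: (egm_O (e := g)); exists y.
Defined.

Definition bicontinuous_embedded_bidcpo_cat : category.
Proof.
by refine (@Category bicontinuous_embedded_bidcpo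
  (fun L1 L2 => embedded_galois_morphism L1 L2)
  (fun L => egm_id L) (fun _ _ _ g f => egm_comp g f) _ _ _)
  => *; apply: egm_ext.
Defined.

(* Main.v *)
From Stdlib Require Import Relation_Definitions.
From mathcomp Require Import all_boot boolp classical_sets.
Require Import Defs.

(** A continuous domain D is sent to the polarity (D, Scott-open filters of D,
    membership), whose specialization order on points is the converse of that
    of D because every u way below v can be separated from below v by a
    Scott-open filter: iterate interpolation to get u << ... << x2 << x1 << v
    and take the upper closure of the chain.  A Galois morphism between such
    polarities is determined by its point part, whose preimage map must be the
    filter part.  Conversely, a bicontinuous bi-dcpo is recovered from K with
    the converse order, its O being the Scott-open filters.
    An embedded bi-dcpo is sent to its polarity of base elements; a Galois
    morphism extends uniquely to the lattices because K is join-dense and O is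
    meet-dense, and every bi-dcpo arises from its Dedekind-MacNeille
    completion.  Both functors are thus fully faithful and essentially
    surjective. *)

Set Implicit Arguments.
Unset Strict Implicit.
Unset Printing Implicit Defensive.

Local Open Scope classical_set_scope.

(** * Equivalences of categories *)

Definition isomorphic_objects (C : category) (a b : C) : Prop :=
  exists (p : hom a b) (q : hom b a), cmp q p = idm a /\ cmp p q = idm b.

(** By choice, [go d] is a preimage of [d] up to isomorphism. Morphisms of [D] are conjugated by [p]
    and [q] and lifted by fullness; faithfulness reduces each equation in [C] to one in [D]. *)
Lemma equivalent_of_fully_faithful (C D : category) (F : functor C D) :
  (forall a b (f : hom (F a) (F b)), exists g : hom a b, fmap F g = f) ->
  (forall a b (f g : hom a b), fmap F f = fmap F g -> f = g) ->
  (forall d : D, exists a, isomorphic_objects (F a) d) ->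
  equivalent_categories C D.
Proof.
move=> full faithful esurj.
pose go d : C := projT1 (cid (esurj d)).
have iso d : isomorphic_objects (F (go d)) d by rewrite /go; case: cid.
pose p d : hom (F (go d)) d := projT1 (cid (iso d)).
have iso_p d : exists q, cmp q (p d) = idm _ /\ cmp (p d) q = idm d.
  by rewrite /p; case: cid.
pose q d : hom d (F (go d)) := projT1 (cid (iso_p d)).
have qp d : cmp (q d) (p d) = idm _ by rewrite /q; case: cid => ? [].
have pq d : cmp (p d) (q d) = idm d by rewrite /q; case: cid => ? [].
pose lift a b (f : hom (F a) (F b)) : hom a b := projT1 (cid (full a b f)).
have liftE a b (f : hom (F a) (F b)) : fmap F (lift a b f) = f.
  by rewrite /lift; case: cid.
pose gm a b (f : hom a b) : hom (go a) (go b) :=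
  lift _ _ (cmp (q b) (cmp f (p a))).
have gm_idm a : gm _ _ (idm a) = idm (go a).
  by apply: faithful; rewrite liftE fmap_id cmp_idl qp.
have gm_cmp a b c (g : hom b c) (f : hom a b) :
    gm _ _ (cmp g f) = cmp (gm _ _ g) (gm _ _ f).
  apply: faithful; rewrite fmap_cmp !liftE -!cmp_assoc.
  by congr cmp; congr cmp; rewrite !cmp_assoc pq cmp_idl.
exists F, (Functor gm_idm gm_cmp); split.
- exists (fun a => lift _ _ (p (F a)) : hom (go (F a)) a).
  exists (fun a => lift _ _ (q (F a)) : hom a (go (F a))); split.
  + move=> a b f; apply: faithful => /=.
    by rewrite !fmap_cmp !liftE !cmp_assoc pq cmp_idl.
  + by move=> a; apply: faithful => /=; rewrite fmap_cmp !liftE qp fmap_id.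
  + by move=> a; apply: faithful => /=; rewrite fmap_cmp !liftE pq fmap_id.
- exists p, q; split=> //= a b f.
  by rewrite /gm liftE !cmp_assoc pq cmp_idl.
Qed.

Lemma equivalent_categories_sym (C D : category) :
  equivalent_categories C D -> equivalent_categories D C.
Proof. by case=> F [G [h1 h2]]; exists G, F. Qed.

(** Whisker [eta'] by [G] and [F], then compose with [eta]. Transitivity uses this for both
    composites, the second time with the two equivalences exchanged and reversed. *)
Lemma naturally_isomorphic_comp3 (C D E : category) (F : functor C D)
    (G : functor D C) (F' : functor D E) (G' : functor E D) :
  naturally_isomorphic (functor_comp G F) (functor_id C) ->
  naturally_isomorphic (functor_comp G' F') (functor_id D) ->
  naturally_isomorphic
    (functor_comp (functor_comp G G') (functor_comp F' F)) (functor_id C).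
Proof.
case=> eta [eps [nat_eta epsK etaK]] [eta' [eps' [nat_eta' epsK' etaK']]].
exists (fun a => cmp (eta a) (fmap G (eta' (F a)))).
exists (fun a => cmp (fmap G (eps' (F a))) (eps a)); split=> /=.
- move=> a b f; rewrite cmp_assoc -nat_eta /= -!cmp_assoc; congr cmp.
  by rewrite -!fmap_cmp -nat_eta'.
- move=> a; rewrite -cmp_assoc [cmp (eps a) _]cmp_assoc epsK cmp_idl.
  by rewrite -fmap_cmp epsK' fmap_id.
- move=> a; rewrite -cmp_assoc [cmp (fmap G _) (cmp _ _)]cmp_assoc.
  by rewrite -fmap_cmp etaK' fmap_id cmp_idl etaK.
Qed.

Lemma equivalent_categories_trans (C D E : category) :
  equivalent_categories C D -> equivalent_categories D E ->
  equivalent_categories C E.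
Proof.
case=> F [G [h1 h2]] [F' [G' [h1' h2']]].
exists (functor_comp F' F), (functor_comp G G').
by split; apply: naturally_isomorphic_comp3.
Qed.

(** * Orders and polarities *)

Lemma converse_order T (le : relation T) :
  Relation_Definitions.order T le ->
  Relation_Definitions.order T (converse le).
Proof.
case=> r t a; split=> [x|x y z xy yz|x y xy yx]; first exact: r.
- exact: t yz xy.
- exact: a.
Qed.

Lemma is_join_unique T (le : relation T) A x y :
  Relation_Definitions.order T le -> is_join le A x -> is_join le A y -> x = y.
Proof.
case=> _ _ anti [ubx lubx] [uby luby].
by apply: anti; [exact: lubx | exact: luby].
Qed.

Lemma exist_ext T (Q : T -> Prop) (x y : {z | Q z}) : sval x = sval y -> x = y.
Proof.
by case: x y => [x Qx] [y Qy] /= e; subst y; rewrite (Prop_irrelevance Qx Qy).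
Qed.

Lemma directed_image A B (r : relation A) (s : relation B) (j : A -> B) X :
  (forall a b, r a b <-> s (j a) (j b)) ->
  directed s (j @` X) <-> directed r X.
Proof.
move=> rs; split=> -[[x0 Xx0] ub]; split.
- by case: Xx0 => x Xx _; exists x.
- move=> x y Xx Xy.
  have [||_ [[z Xz <-] xz yz]] := ub (j x) (j y); [by exists x|by exists y|].
  by exists z; split=> //; apply/rs.
- by exists (j x0), x0.
- move=> _ _ [x Xx <-] [y Xy <-]; have [z [Xz xz yz]] := ub x y Xx Xy.
  by exists (j z); split; [exists z | exact/rs | exact/rs].
Qed.

(** The second hypothesis says that the image of [j] is meet-dense, so an upper bound in [B] can be
    tested through the elements [j a] above it, which are upper bounds coming from [A]. *)
Lemma is_join_image A B (r : relation A) (s : relation B) (j : A -> B) X m :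
  (forall a b, r a b <-> s (j a) (j b)) ->
  (forall x y, (forall a, s y (j a) -> s x (j a)) -> s x y) ->
  Relation_Definitions.transitive B s ->
  is_join s (j @` X) (j m) <-> is_join r X m.
Proof.
move=> rs dense strans; split=> -[ub lub]; split.
- by move=> x Xx; apply/rs/ub; exists x.
- by move=> y yub; apply/rs/lub => _ [x Xx <-]; apply/rs/yub.
- by move=> _ [x Xx <-]; apply/rs/ub.
- move=> y yub; apply: dense => a ya; apply/rs/lub => x Xx; apply/rs.
  by apply: strans ya; apply: yub; exists x.
Qed.

(** Right inverses of [a] and [b] are two-sided: [k] and [a' (a k)] have the same relations, and
    purification of [P1] identifies them; likewise for [b]. *)
Lemma surj_polarity_iso (P1 P2 : polarity) (a : pol_K P1 -> pol_K P2)
    (b : pol_O P1 -> pol_O P2) :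
  purified P1 -> (forall k, exists l, a l = k) -> (forall u, exists v, b v = u) ->
  (forall k u, pol_rel (a k) (b u) <-> pol_rel k u) ->
  exists (f : galois_morphism P2 P1) (g : galois_morphism P1 P2),
    gm_comp g f = gm_id P2 /\ gm_comp f g = gm_id P1.
Proof.
move=> [[_ _ antiK] [_ _ antiO]] /choice[a' a'K] /choice[b' b'K] ab.
have Hf k u : pol_rel (a' k) u <-> pol_rel k (b u) by rewrite -ab a'K.
have Hg k u : pol_rel (a k) u <-> pol_rel k (b' u) by rewrite -ab b'K.
exists (GaloisMorphism Hf), (GaloisMorphism Hg); split.
- by apply: gm_ext; apply/funext => x /=; rewrite ?a'K ?b'K.
- apply: gm_ext; apply/funext => x /=.
    by apply: antiK => u /= /ab h; apply/ab; move: h; rewrite a'K.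
  by apply: antiO => k /= /ab h; apply/ab; move: h; rewrite b'K.
Qed.

(** * Continuous domains *)

Lemma way_below_le T (le : relation T) u v :
  is_continuous_domain le -> way_below le u v -> le u v.
Proof. by case=> _ cont uv; have [_ [ub _]] := cont v; exact: ub. Qed.

Lemma way_below_trans T (le : relation T) u v w z :
  Relation_Definitions.order T le ->
  le u v -> way_below le v w -> le w z -> way_below le u z.
Proof.
move=> [_ tr _] uv vw wz E j dE jE zj.
have [e Ee ve] := vw E j dE jE (tr _ _ _ wz zj).
by exists e => //; exact: tr ve.
Qed.

(** Such a [B] is cofinal among the elements way below [u]: each of them lies below a member of [B],
    as [u] is the directed join of [B]. *)
Lemma continuous_domain_of_directed T (le : relation T) : is_dcpo le ->
  (forall u, exists B, [/\ B `<=` [set v | way_below le v u],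
                           directed le B & is_join le B u]) ->
  is_continuous_domain le.
Proof.
move=> dcpo basis; have [[rf tr _] _] := dcpo.
split=> // u; have [B [Bu dB jB]] := basis u.
have inB v : way_below le v u -> exists2 b, B b & le v b.
  by move=> vu; exact: vu (rf u).
split; [split|split].
- by have [[b Bb] _] := dB; exists b; exact: Bu.
- move=> x y /inB[b Bb xb] /inB[c Bc yc].
  have [z [Bz bz cz]] := dB.2 b c Bb Bc.
  by exists z; split; [exact: Bu | exact: tr bz | exact: tr cz].
- by move=> v /inB[b Bb vb]; apply: tr vb _; exact: jB.1.
- by move=> y yub; apply: jB.2 => b Bb; apply: yub; exact: Bu.
Qed.

Lemma way_below_interpolation T (le : relation T) u v :
  is_continuous_domain le -> way_below le u v ->
  exists2 w, way_below le u w & way_below le w v.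
Proof.
move=> cd uv; have [[ord _] cont] := cd; have [rf tr anti] := ord.
(* The elements two way-below steps under [v] still form a directed set with join [v], so [u] lies
   below one of them. *)
pose E := [set x | exists2 w, way_below le x w & way_below le w v].
have dE : directed le E.
  split=> [|x y [w xw wv] [w' yw' w'v]].
    have [[w wv] _] := (cont v).1; have [[x xw] _] := (cont w).1.
    by exists x, w.
  have [z [zv wz w'z]] := (cont v).1.2 w w' wv w'v.
  have [] := (cont z).1.2 x y.
  - exact: way_below_trans (rf _) xw wz.
  - exact: way_below_trans (rf _) yw' w'z.
  by move=> t [tz xt yt]; exists t; split=> //; exists z.
have jE : is_join le E v.
  split=> [x [w xw wv]|y yub].
    exact: tr (way_below_le cd xw) (way_below_le cd wv).
  apply: (cont v).2.2 => w wv; apply: (cont w).2.2 => x xw.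
  by apply: yub; exists w.
have [e [w ew wv] ue] := uv E v dE jE (rf v).
by exists w => //; exact: way_below_trans ue ew (rf w).
Qed.

Lemma scott_open_filter_between T (le : relation T) u v :
  is_continuous_domain le -> way_below le u v ->
  exists F, [/\ scott_open_filter le F, F v & F `<=` le u].
Proof.
move=> cd uv; have [[[rf tr _] _] _] := cd.
(* [g] is made total by returning [w] itself when [u] is not way below [w]; the chain started at [v]
   never meets this case, by [ux]. *)
have /choice[g gP] w : exists z, way_below le u w ->
    way_below le u z /\ way_below le z w.
  have [uw|nuw] := pselect (way_below le u w); last by exists w.
  by have [z] := way_below_interpolation cd uw; exists z.
pose x n := iter n g v.
have ux n : way_below le u (x n) by elim: n => //= n /gP[].
have xS n : way_below le (x n.+1) (x n) by have [] := gP _ (ux n).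
have xD n m : le (x (m + n)) (x n).
  elim: m => [|m IHm]; first exact: rf.
  by apply: tr IHm; rewrite addSn; exact: way_below_le cd (xS _).
exists [set y | exists n, le (x n) y]; split.
- split; [split| |].
  + by exists v, 0; exact: rf.
  + move=> y z [n ny] [m mz]; exists (x (n + m)); split.
    * by exists (n + m); exact: rf.
    * by apply: tr ny; rewrite addnC; exact: xD.
    * by apply: tr mz; exact: xD.
  + by move=> y z [n ny] yz; exists n; exact: tr yz.
  (* Openness costs one index: [x n.+1] is way below [x n], hence below a member of [I]. *)
  + move=> I j dI jI [n nj]; have [e Ie ne] := xS n I j dI jI nj.
    by exists e; split=> //; exists n.+1.
- by exists 0; exact: rf.
- by move=> y [n ny]; apply: tr ny; exact: way_below_le cd (ux n).
Qed.

(** Roundedness of Scott-open filters: [x] is the directed join of the elements way below it, so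
    openness puts one of them in [F]. *)
Lemma scott_open_filter_way_below T (le : relation T) F x :
  is_continuous_domain le -> scott_open_filter le F -> F x ->
  exists2 y, F y & way_below le y x.
Proof.
move=> [_ cont] [_ _ op] Fx; have [dx jx] := cont x.
by have [y [yx Fy]] := op _ _ dx jx Fx; exists y.
Qed.

(** * The polarity of points and Scott-open filters of a continuous domain *)

Section DomainPolarity.
Variable D : continuous_domain.

Let le := @cd_le D.
Let cd : is_continuous_domain le := cd_axiom D.

Definition domain_polarity : polarity :=
  @Polarity D {F : set D | scott_open_filter le F} (fun k F => sval F k).

Lemma domain_leKE : @leK domain_polarity = converse le.
Proof.
have [[[rf tr anti] _] cont] := cd.
apply/funext => k; apply/funext => l; apply/propext; split=> [kl|lk F /= Fl].
  (* Each [x] way below [l] is below [k], because a filter between [x] and [l] must contain [k]; and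
     [l] is the join of these [x]. *)
  apply: (cont l).2.2 => x xl.
  have [F [oF Fl Fx]] := scott_open_filter_between cd xl.
  exact/Fx/(kl (exist _ F oF)).
by case: F Fl => F [_ up _] /= Fl; exact: up lk.
Qed.

Lemma domain_purified : purified domain_polarity.
Proof.
split; first by rewrite domain_leKE; apply: converse_order; exact: cd.1.1.
split=> [F|F G H FG GH|F G FG GF] //.
- by move=> k Fk; exact/GH/FG.
- by apply: exist_ext; rewrite eqEsubset.
Qed.

(** Makes directed joins in [O] unions, so that [bd_compact] becomes membership in a union.
    Directedness puts two points into a common filter, where codirectedness applies. *)
Lemma scott_open_filter_bigcup (I : set (pol_O domain_polarity)) :
  directed (@leO domain_polarity) I ->
  scott_open_filter le [set k | exists2 F, I F & sval F k].
Proof.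
move=> [[F0 IF0] dir]; split; [split| |].
- have [[[k0 Fk0] _] _ _] := svalP F0.
  by exists k0, F0.
- move=> x y [F IF Fx] [G IG Gy]; have [H [IH FH GH]] := dir F G IF IG.
  have [[_ coH] _ _] := svalP H.
  have [z [Hz zx zy]] := coH x y (FH _ Fx) (GH _ Gy).
  by exists z; split=> //; exists H.
- by move=> x y [F IF Fx] xy; exists F => //; have [_ up _] := svalP F; exact: up xy.
- move=> E j dE jE [F IF Fj]; have [_ _ op] := svalP F.
  by have [e [Ee Fe]] := op E j dE jE Fj; exists e; split=> //; exists F.
Qed.

Lemma is_join_bigcup (I : set (pol_O domain_polarity))
    (dI : directed (@leO domain_polarity) I) :
  is_join (@leO domain_polarity) I (exist _ _ (scott_open_filter_bigcup dI)).
Proof.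
split=> [F IF k Fk|F ub k [G IG Gk]]; first by exists F.
exact: ub Gk.
Qed.

(** By [domain_leKE], codirected meets of points are directed joins in [D], and [bd_cocompact] is
    Scott openness. *)
Lemma domain_bidcpo : is_bidcpo domain_polarity.
Proof.
split.
- exact: domain_purified.
- by rewrite domain_leKE; exact: cd.1.2.
- by move=> I dI; exists (exist _ _ (scott_open_filter_bigcup dI)); exact: is_join_bigcup.
- move=> k I j dI jI kj; move: kj.
  by rewrite (is_join_unique domain_purified.2 jI (is_join_bigcup dI)).
- rewrite domain_leKE => -[F oF] E m dE mE /= Fm.
  by have [_ _ op] := oF; have [k []] := op E m dE mE Fm; exists k.
Qed.

Lemma domain_bicontinuous : bicontinuous domain_polarity.
Proof.
have [[[rf tr anti] _] cont] := cd.
split.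
- move=> k [F oF] /= Fk; have [k' Fk' k'k] := scott_open_filter_way_below cd oF Fk.
  have [G [oG Gk Gk']] := scott_open_filter_between cd k'k.
  exists (exist _ G oG), k'; split=> //.
  by rewrite /black_rel /downKK domain_leKE.
- by move=> [F [coF up op]]; rewrite domain_leKE.
- move=> k; split.
    have [[x xk] _] := (cont k).1.
    by have [F [oF Fk _]] := scott_open_filter_between cd xk; exists (exist _ F oF).
  move=> [F oF] [G oG] /= Fk Gk.
  (* A filter inside both [F] and [G]: shrink [k] to [x] in [F] and [y] in [G], take [z] way below
     [k] above both, and separate [z] from [k]. *)
  have [x Fx xk] := scott_open_filter_way_below cd oF Fk.
  have [y Gy yk] := scott_open_filter_way_below cd oG Gk.
  have [z [zk xz yz]] := (cont k).1.2 x y xk yk.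
  have [H [oH Hk Hz]] := scott_open_filter_between cd zk.
  have [_ upF _] := oF; have [_ upG _] := oG.
  exists (exist _ H oH); split=> // t /Hz zt /=.
  + exact: upF Fx (tr _ _ _ xz zt).
  + exact: upG Gy (tr _ _ _ yz zt).
Qed.

Definition domain_bidcpo_object : bicontinuous_bidcpo :=
  BicontinuousBidcpo domain_bidcpo domain_bicontinuous.

End DomainPolarity.

Definition domain_galois (D1 D2 : continuous_domain)
    (f : open_filter_morphism D1 D2) :
    galois_morphism (domain_polarity D1) (domain_polarity D2) :=
  @GaloisMorphism (domain_polarity D1) (domain_polarity D2) (ofm_fun f)
    (fun F => exist _ (ofm_fun f @^-1` sval F) (ofm_axiom f (svalP F)))
    (fun _ _ => iff_refl _).

Definition domain_functor :
  functor continuous_domain_cat bicontinuous_bidcpo_cat.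
Proof.
refine (@Functor continuous_domain_cat bicontinuous_bidcpo_cat
  domain_bidcpo_object (fun _ _ f => domain_galois f) _ _).
- by move=> D; apply: gm_ext => //; apply/funext => F; exact: exist_ext.
- by move=> D1 D2 D3 g f; apply: gm_ext => //; apply/funext => F; exact: exist_ext.
Defined.

(** * The continuous domain of points of a bicontinuous bi-dcpo *)

Section PointDomain.
Variable P : bicontinuous_bidcpo.

Let bd := bb_bidcpo P.
Let le := converse (@leK P).

(** A directed basis at [k] for the converse order, described without [way_below]. *)
Definition approx (k : pol_K P) : set (pol_K P) :=
  [set k' | exists2 u, pol_rel k u & black_rel u k'].

(** The witness [u] for [l] is related to the limit of [E], hence by cocompactness to some [e] in
    [E]; then [e] is below [l] in [leK]. *)
Lemma approx_way_below k : approx k `<=` [set l | way_below le l k].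
Proof.
move=> l [u ku ul] E j dE jE kj.
have [e Ee eu] := bd_cocompact bd dE jE (kj u ku).
by exists e => //; exact: ul.
Qed.

Lemma directed_approx k : directed le (approx k).
Proof.
have [lc _ co] := bb_bicontinuous P; split.
  have [[u ku] _] := co k; have [u' [k' [ku' u'k' _]]] := lc k u ku.
  by exists k', u'.
move=> x y [u ku ux] [v kv vy]; have [w [kw wu wv]] := (co k).2 u v ku kv.
have [w' [k' [kw' w'k' k'w]]] := lc k w kw.
exists k'; split; first by exists w'.
- exact/ux/wu.
- exact/vy/wv.
Qed.

Lemma is_join_approx k : is_join le (approx k) k.
Proof.
have [lc _ _] := bb_bicontinuous P; split=> [x [u ku ux]|y yub u ku].
  exact: ux.
have [u' [k' [ku' u'k' k'u]]] := lc k u ku.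
by apply: (yub k') => //; exists u'.
Qed.

Lemma point_continuous : is_continuous_domain le.
Proof.
apply: continuous_domain_of_directed.
  by split; [exact: converse_order (bd_purified bd).1 | exact: bd_meets bd].
move=> k; exists (approx k); split.
- exact: approx_way_below.
- exact: directed_approx.
- exact: is_join_approx.
Qed.

Definition point_domain : continuous_domain := ContinuousDomain point_continuous.

Lemma downK_scott_open (u : pol_O P) : scott_open_filter le (downK u).
Proof.
have [_ dir _] := bb_bicontinuous P; split; first exact: dir.
- by move=> x y xu yx; exact: yx.
- by move=> I j dI jI ju; have [k Ik ku] := bd_cocompact bd dI jI ju; exists k.
Qed.

(** The required [u] is the join of the [I] below. Compactness keeps its [downK] inside [F]; local
    compactness, through [approx], makes it cover [F]. *)
Lemma scott_open_downK F : scott_open_filter le F ->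
  exists u : pol_O P, downK u = F.
Proof.
move=> oF; have [coF up op] := oF.
have approxF k : F k -> exists u k', [/\ pol_rel k u, black_rel u k' & F k'].
  move=> Fk; have [k' [[u ku uk'] Fk']] := op _ _ (directed_approx k) (is_join_approx k) Fk.
  by exists u, k'.
pose I := [set u : pol_O P | exists2 k, F k & black_rel u k].
have dI : directed (@leO P) I.
  split=> [|u v [k Fk uk] [l Fl vl]].
    by have [[k /approxF[u [k' [_ uk' Fk']]]] _] := coF; exists u, k'.
  have [m [Fm km lm]] := coF.2 k l Fk Fl.
  have [w [m' [mw wm' Fm']]] := approxF m Fm.
  (* In [leK], [m] lies above [k] and [l], so everything below either of them is related to [w]. *)
  exists w; split; first by exists m'.
  - by move=> x /uk xk; apply: (xk w); exact: km.
  - by move=> x /vl xl; apply: (xl w); exact: lm.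
have [j jI] := bd_joins bd dI; exists j; rewrite eqEsubset; split=> k.
  move=> /(bd_compact bd dI jI)[u [l Fl ul] ku].
  by apply: up Fl _; exact: ul.
move=> /approxF[u [k' [ku uk' Fk']]].
by apply: (jI.1 u) => //; exists k'.
Qed.

Lemma point_domain_iso :
  exists (f : galois_morphism (domain_polarity point_domain) P)
         (g : galois_morphism P (domain_polarity point_domain)),
    gm_comp g f = gm_id _ /\ gm_comp f g = gm_id P.
Proof.
apply: (@surj_polarity_iso P (domain_polarity point_domain) id
  (fun u => exist _ (downK u) (downK_scott_open u))) => //.
- exact: bd_purified bd.
- by move=> k; exists k.
- move=> [F oF]; have [u uF] := scott_open_downK oF.
  by exists u; exact: exist_ext.
Qed.

End PointDomain.

Lemma domain_bidcpo_equivalence :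
  equivalent_categories continuous_domain_cat bicontinuous_bidcpo_cat.
Proof.
apply: (@equivalent_of_fully_faithful _ _ domain_functor).
- move=> D1 D2 [phi box adj].
  have phi_filter F : scott_open_filter (@cd_le D2) F ->
      scott_open_filter (@cd_le D1) (phi @^-1` F).
    move=> oF; suff -> : phi @^-1` F = sval (box (exist _ F oF)) by exact: svalP.
    by apply/seteqP; split=> k /=; [move/(adj k (exist _ F oF)) | move=> /adj].
  exists (OpenFilterMorphism phi_filter); apply: gm_ext => //.
  apply/funext => F; apply: exist_ext; apply/seteqP; split=> k /=.
  + by move/adj.
  + by move=> /adj.
- by move=> D1 D2 f g /(congr1 (@gm_phi _ _)) /= fg; exact: ofm_ext.
- by move=> P; exists (point_domain P); exact: point_domain_iso.
Qed.

(** * Embedded bi-dcpos *)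

Lemma db_joinP (L : double_base_lattice) (x y : L) :
  (forall k, db_K k -> db_le k x -> db_le k y) -> db_le x y.
Proof.
by move=> xy; have [A AK [ub lub]] := db_join_base x; apply: lub => k Ak;
  apply: xy; [exact: AK | exact: ub].
Qed.

Lemma db_meetP (L : double_base_lattice) (x y : L) :
  (forall u, db_O u -> db_le y u -> db_le x u) -> db_le x y.
Proof.
by move=> xy; have [A AO [ub lub]] := db_meet_base y; apply: lub => u Au;
  apply: xy; [exact: AO | exact: ub].
Qed.

(** * Transfer between a polarity and a lattice whose two bases represent it *)

Section Representation.
Variables (P : polarity) (L : double_base_lattice).
Variables (i : pol_K P -> L) (o : pol_O P -> L).
Hypothesis rangeK : @db_K L = range i.
Hypothesis rangeO : @db_O L = range o.
Hypothesis relE : forall k u, pol_rel k u <-> db_le (i k) (o u).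

Let le := @db_le L.
Let ordL : Relation_Definitions.order L le. Proof. by case: (db_complete L). Qed.
Let rf := ord_refl _ _ ordL.
Let tr := ord_trans _ _ ordL.
Let anti := ord_antisym _ _ ordL.

Let Ki k : @db_K L (i k). Proof. by rewrite rangeK; exists k. Qed.
Let Oo u : @db_O L (o u). Proof. by rewrite rangeO; exists u. Qed.

Let denseK x y : (forall k, le (i k) x -> le (i k) y) -> le x y.
Proof. by move=> xy; apply: db_joinP => k; rewrite rangeK => -[l _ <-]; exact: xy. Qed.

Let denseO x y : (forall u, le y (o u) -> le x (o u)) -> le x y.
Proof. by move=> xy; apply: db_meetP => u; rewrite rangeO => -[v _ <-]; exact: xy. Qed.

(** [leK] tests against [O] only, and this detects the order of [L] because [O] is meet-dense;
    [leO_rep] uses join-density of [K] dually. *)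
Lemma leK_rep k l : leK k l <-> le (i k) (i l).
Proof.
split=> [kl|kl u /relE lu]; last by apply/relE; exact: tr lu.
by apply: denseO => u /relE lu; exact/relE/kl.
Qed.

Lemma leO_rep u v : leO u v <-> le (o u) (o v).
Proof.
split=> [uv|uv k /relE ku]; last by apply/relE; exact: tr uv.
by apply: denseK => k /relE ku; exact/relE/uv.
Qed.

Lemma black_rep u k : black_rel u k <-> le (o u) (i k).
Proof.
split=> [uk|uk l /relE lu]; last by apply/leK_rep; exact: tr uk.
by apply: denseK => l /relE lu; exact/leK_rep/uk.
Qed.

Let codirectedE X : codirected le (i @` X) <-> codirected (@leK P) X.
Proof. by apply: directed_image => k l; exact: leK_rep. Qed.

Let directedE X : directed le (o @` X) <-> directed (@leO P) X.
Proof. by apply: directed_image; exact: leO_rep. Qed.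

Let is_meetE X m : is_meet le (i @` X) (i m) <-> is_meet (@leK P) X m.
Proof.
apply: is_join_image; first by move=> k l; exact: leK_rep.
- by move=> x y xy; apply: denseK.
- by move=> x y z xy yz; exact: tr yz xy.
Qed.

Let is_joinE X m : is_join le (o @` X) (o m) <-> is_join (@leO P) X m.
Proof. by apply: is_join_image; [exact: leO_rep | exact: denseO | exact: tr]. Qed.

Let imageK F : F `<=` @db_K L -> exists X, F = i @` X.
Proof.
rewrite rangeK => Fi; exists (i @^-1` F).
by apply/seteqP; split=> [x Fx|_ [k Fk <-] //]; have [k _ kx] := Fi x Fx;
  exists k => //=; rewrite kx.
Qed.

Let imageO I : I `<=` @db_O L -> exists X, I = o @` X.
Proof.
rewrite rangeO => Io; exists (o @^-1` I).
by apply/seteqP; split=> [x Ix|_ [u Iu <-] //]; have [u _ ux] := Io x Ix;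
  exists u => //=; rewrite ux.
Qed.

Let belowE u : [set k | db_K k /\ db_le k (o u)] = i @` downK u.
Proof.
apply/seteqP; split=> [x /=|_ [k ku <-]]; last by split=> //; exact/relE.
by rewrite rangeK => -[[k _ <-] ku]; exists k => //; exact/relE.
Qed.

Let aboveE k : [set u | db_O u /\ db_le (i k) u] = o @` upO k.
Proof.
apply/seteqP; split=> [x /=|_ [u ku <-]]; last by split=> //; exact/relE.
by rewrite rangeO => -[[u _ <-] ku]; exists u => //; exact/relE.
Qed.

Let codirected_aboveE (A : set (pol_O P)) :
  codirected le (o @` A) <-> codirected (@leO P) A.
Proof. by apply: directed_image => u v; exact: leO_rep. Qed.

Let directed_belowE (A : set (pol_K P)) :
  directed le (i @` A) <-> directed (@leK P) A.
Proof. by apply: directed_image => u v; exact: leK_rep. Qed.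

Lemma embedded_bidcpo_of_rep : is_bidcpo P -> is_embedded_bidcpo L.
Proof.
move=> bd; split.
- move=> _ m /imageK[X ->] /codirectedE dX mX.
  have [m' m'X] := bd_meets bd dX.
  (* The meet formed in [P] is also a meet in [L], so uniqueness places [m] in the range of [i]. *)
  rewrite (is_join_unique (converse_order ordL) mX ((is_meetE X m').2 m'X)).
  exact: Ki.
- move=> _ j /imageO[X ->] /directedE dX jX.
  have [j' j'X] := bd_joins bd dX.
  rewrite (is_join_unique ordL jX ((is_joinE X j').2 j'X)).
  exact: Oo.
- move=> x I j; rewrite {1}rangeK => -[k _ <-] /imageO[X ->] /directedE dX jX.
  have [j' j'X] := bd_joins bd dX.
  rewrite (is_join_unique ordL jX ((is_joinE X j').2 j'X)) => /relE kj.
  have [u Xu ku] := bd_compact bd dX j'X kj.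
  by exists (o u); [exists u | exact/relE].
- move=> x F m; rewrite {1}rangeO => -[u _ <-] /imageK[X ->] /codirectedE dX mX.
  have [m' m'X] := bd_meets bd dX.
  rewrite (is_join_unique (converse_order ordL) mX ((is_meetE X m').2 m'X)).
  move=> /relE mu; have [k Xk ku] := bd_cocompact bd dX m'X mu.
  by exists (i k); [exists k | exact/relE].
Qed.

Lemma embedded_bicontinuous_of_rep : bicontinuous P -> embedded_bicontinuous L.
Proof.
move=> [lc dir codir]; split.
- move=> x y; rewrite {1}rangeK {1}rangeO => -[k _ <-] [u _ <-] /relE ku.
  have [u' [k' [ku' u'k' k'u]]] := lc k u ku.
  by exists (o u'), (i k'); split=> //; by [exact/relE | exact/black_rep].
- by move=> x; rewrite {1}rangeO => -[u _ <-]; rewrite belowE; exact/directed_belowE.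
- by move=> x; rewrite {1}rangeK => -[k _ <-]; rewrite aboveE; exact/codirected_aboveE.
Qed.

(** Injectivity turns antisymmetry of [L] into purification. Meets and joins exist in [L] by
    completeness, and the closure conditions bring them back into the bases. *)
Lemma bidcpo_of_rep :
  injective i -> injective o -> is_embedded_bidcpo L -> is_bidcpo P.
Proof.
move=> inji injo bd; split.
- split; split.
  + by move=> k; apply/leK_rep.
  + by move=> k l m /leK_rep kl /leK_rep lm; apply/leK_rep; exact: tr lm.
  + by move=> k l /leK_rep kl /leK_rep lk; apply: inji; exact: anti.
  + by move=> k; apply/leO_rep.
  + by move=> k l m /leO_rep kl /leO_rep lm; apply/leO_rep; exact: tr lm.
  + by move=> k l /leO_rep kl /leO_rep lk; apply: injo; exact: anti.
- move=> F /codirectedE dF; have [_ _ /(_ (i @` F))[m mF]] := db_complete L.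
  have : db_K m by apply: (ebd_meets bd _ dF mF) => _ [k _ <-].
  by rewrite rangeK => -[k _ km]; exists k; apply/is_meetE; rewrite km.
- move=> I /directedE dI; have [_ /(_ (o @` I))[j jI] _] := db_complete L.
  have : db_O j by apply: (ebd_joins bd _ dI jI) => _ [u _ <-].
  by rewrite rangeO => -[u _ uj]; exists u; apply/is_joinE; rewrite uj.
- move=> k I j /directedE dI /is_joinE jI /relE kj.
  have [|_ [u Iu <-] ku] := ebd_compact bd (Ki k) _ dI jI kj.
    by move=> _ [u _ <-].
  by exists u => //; exact/relE.
- move=> u F m /codirectedE dF /is_meetE mF /relE mu.
  have [|_ [k Fk <-] ku] := ebd_cocompact bd (Oo u) _ dF mF mu.
    by move=> _ [k _ <-].
  by exists k => //; exact/relE.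
Qed.

Lemma bicontinuous_of_rep : embedded_bicontinuous L -> bicontinuous P.
Proof.
move=> [lc dir codir]; split.
- move=> k u /relE ku; have [x [y []]] := lc _ _ (Ki k) (Oo u) ku.
  rewrite rangeK rangeO => -[u' _ <-] [k' _ <-] /relE ku' u'k' /relE k'u.
  by exists u', k'; split=> //; exact/black_rep.
- by move=> u; apply/directed_belowE; rewrite -belowE; exact: dir.
- by move=> k; apply/codirected_aboveE; rewrite -aboveE; exact: codir.
Qed.

End Representation.

(** * The functor from embedded bi-dcpos to polarities of base elements *)

Definition base_polarity (L : double_base_lattice) : polarity :=
  @Polarity {x : L | db_K x} {x : L | db_O x}
    (fun k u => db_le (sval k) (sval u)).

Lemma range_sval T (A : set T) : A = range (@sval T A).
Proof.
apply/seteqP; split=> [x Ax|_ [[x Ax] _ <-] //].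
by exists (exist _ x Ax).
Qed.

Section BaseFunctor.
Variable L : bicontinuous_embedded_bidcpo.

Lemma base_bidcpo : is_bidcpo (base_polarity L).
Proof.
apply: (@bidcpo_of_rep (base_polarity L) L sval sval
  (range_sval _) (range_sval _)) => //.
- exact: exist_ext.
- exact: exist_ext.
- exact: beb_bidcpo.
Qed.

Lemma base_bicontinuous : bicontinuous (base_polarity L).
Proof.
apply: (@bicontinuous_of_rep (base_polarity L) L sval sval
  (range_sval _) (range_sval _)) => //.
exact: beb_bicontinuous.
Qed.

Definition base_object : bicontinuous_bidcpo :=
  BicontinuousBidcpo base_bidcpo base_bicontinuous.

End BaseFunctor.

Definition base_galois (L1 L2 : double_base_lattice)
    (f : embedded_galois_morphism L1 L2) :
    galois_morphism (base_polarity L1) (base_polarity L2) :=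
  @GaloisMorphism (base_polarity L1) (base_polarity L2)
    (fun k => exist _ (egm_phi f (sval k))
       (egm_K (imageP (egm_phi f) (svalP k))))
    (fun u => exist _ (egm_box f (sval u))
       (egm_O (imageP (egm_box f) (svalP u))))
    (fun k u => egm_adj f (sval k) (sval u)).

Definition base_functor :
  functor bicontinuous_embedded_bidcpo_cat bicontinuous_bidcpo_cat.
Proof.
refine (@Functor bicontinuous_embedded_bidcpo_cat bicontinuous_bidcpo_cat
  base_object (fun _ _ f => base_galois f) _ _).
- by move=> L; apply: gm_ext; apply/funext => F; exact: exist_ext.
- by move=> L1 L2 L3 g f; apply: gm_ext; apply/funext => F; exact: exist_ext.
Defined.

(* An adjoint pair is determined by the right adjoint on the meet-dense O. *)
Lemma base_galois_inj (L1 L2 : double_base_lattice)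
    (f g : embedded_galois_morphism L1 L2) :
  base_galois f = base_galois g -> f = g.
Proof.
move=> /(congr1 (@gm_box _ _)) fg.
have boxO u : db_O u -> egm_box f u = egm_box g u.
  by move=> Ou; have /(congr1 sval) := congr1 (@^~ (exist _ u Ou)) fg.
have [[rf1 tr1 anti1] _ _] := db_complete L1.
have [[rf2 tr2 anti2] _ _] := db_complete L2.
have phi_eq : egm_phi f = egm_phi g.
  apply/funext => x; apply: anti2; apply: db_meetP => u Ou /egm_adj xu;
    by apply/egm_adj; rewrite boxO in xu *.
apply: egm_ext => //; apply/funext => y; apply: anti1.
- by apply/egm_adj; rewrite -phi_eq; apply/egm_adj; exact: rf1.
- by apply/egm_adj; rewrite phi_eq; apply/egm_adj; exact: rf1.
Qed.

(** Extend the left part to [L1] by joins over [K] and the right part to [L2] by meets over [O]. By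
    density, the adjunction reduces to [gm_axiom] on base elements. *)
Lemma base_galois_surj (L1 L2 : double_base_lattice)
    (g : galois_morphism (base_polarity L1) (base_polarity L2)) :
  exists f : embedded_galois_morphism L1 L2, base_galois f = g.
Proof.
have [[rf1 tr1 anti1] _ meets] := db_complete L1.
have [[rf2 tr2 anti2] joins _] := db_complete L2.
have /choice[phi phiP] x := joins [set sval (gm_phi g k) | k in
  [set k : {y : L1 | db_K y} | db_le (sval k) x]].
have /choice[box boxP] y := meets [set sval (gm_box g u) | u in
  [set u : {z : L2 | db_O z} | db_le y (sval u)]].
have phi_ub x k : db_le (sval k) x -> db_le (sval (gm_phi g k)) (phi x).
  by move=> kx; apply: (phiP x).1; exists k.
have box_lb y u : db_le y (sval u) -> db_le (box y) (sval (gm_box g u)).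
  by move=> yu; apply: (boxP y).1; exists u.
have adj x y : db_le (phi x) y <-> db_le x (box y).
  split=> [xy|xy].
  - apply: (boxP y).2 => _ [u yu <-]; apply: db_joinP => k Kk kx.
    apply/(gm_axiom g (exist _ k Kk) u)/(tr2 _ _ _ _ yu)/(tr2 _ _ _ _ xy).
    exact: phi_ub.
  - apply: (phiP x).2 => _ [k kx <-]; apply: db_meetP => u Ou yu.
    apply/(gm_axiom g k (exist _ u Ou)).
    by apply: (tr1 _ _ _ kx); apply: (tr1 _ _ _ xy); exact: box_lb.
(* The extension agrees with [gm_phi g] on [K] since [gm_phi g] is monotone, which follows from
   [gm_axiom] and meet-density of [O]. *)
have phiK k : phi (sval k) = sval (gm_phi g k).
  apply: anti2; last exact: phi_ub.
  apply: (phiP _).2 => _ [l lk <-]; apply: db_meetP => u Ou.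
  move=> /(gm_axiom g k (exist _ u Ou)) ku.
  by apply/(gm_axiom g l (exist _ u Ou)); exact: tr1 ku.
have boxO u : box (sval u) = sval (gm_box g u).
  apply: anti1; first exact: box_lb.
  apply: (boxP _).2 => _ [v uv <-]; apply: db_joinP => k Kk.
  move=> /(gm_axiom g (exist _ k Kk) u) ku.
  by apply/(gm_axiom g (exist _ k Kk) v); exact: tr2 uv.
have imK : phi @` @db_K L1 `<=` @db_K L2.
  by move=> _ [k Kk <-]; rewrite (phiK (exist _ k Kk)); exact: svalP.
have imO : box @` @db_O L2 `<=` @db_O L1.
  by move=> _ [u Ou <-]; rewrite (boxO (exist _ u Ou)); exact: svalP.
by exists (EmbeddedGaloisMorphism adj imK imO); apply: gm_ext;
  apply/funext => x; apply: exist_ext; rewrite /= ?phiK ?boxO.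
Qed.

(** * The Dedekind-MacNeille completion of a polarity *)

Section Completion.
Variable P : polarity.

Definition upper (A : set (pol_K P)) : set (pol_O P) :=
  [set u | A `<=` downK u].

Definition lower (B : set (pol_O P)) : set (pol_K P) :=
  [set k | B `<=` upO k].

(** The cuts of the completion; the reverse inclusion holds for every [A]. *)
Definition galois_closed (A : set (pol_K P)) : Prop := lower (upper A) `<=` A.

Lemma lower_closed B : galois_closed (lower B).
Proof. by move=> k kB u Bu; apply: kB => l; exact. Qed.

Definition completion : Type := {A | galois_closed A}.

Definition completion_le : relation completion := fun x y => sval x `<=` sval y.

Definition lower_cut B : completion := exist _ (lower B) (@lower_closed B).

(** As sets, [cutK k] is [downKK k] and [cutO u] is [downK u]. *)
Definition cutK (k : pol_K P) : completion := lower_cut (upO k).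

Definition cutO (u : pol_O P) : completion := lower_cut [set u].

Lemma cut_rel k u : pol_rel k u <-> completion_le (cutK k) (cutO u).
Proof.
split=> [ku l kl _ ->|ku]; first exact: kl.
exact: (ku k (fun _ => id) u erefl).
Qed.

Lemma completion_complete : is_complete_lattice completion_le.
Proof.
split.
- split=> [x //|x y z xy yz k /xy /yz //|x y xy yx].
  by apply: exist_ext; apply/seteqP.
(* A join is the closure of the union, whereas the intersection used for a meet is already
   closed. *)
- move=> S; exists (lower_cut (upper (\bigcup_(x in S) sval x))); split.
    by move=> x Sx k xk u; apply; exists x.
  move=> y yub k ku; apply: (svalP y) => u yu; apply: ku => l [x Sx xl].
  by apply: yu; exact: yub xl.
- move=> S.
  have closed : galois_closed (\bigcap_(x in S) sval x).
    move=> k ku x Sx; apply: (svalP x) => u xu; apply: ku => l lS.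
    by apply: xu; exact: lS.
  exists (exist _ _ closed); split; first by move=> x Sx k; exact.
  by move=> y ylb k yk x Sx; exact: ylb yk.
Qed.

Lemma completion_join_base x :
  exists2 A, A `<=` range cutK & is_join completion_le A x.
Proof.
exists (cutK @` sval x); first by move=> _ [k _ <-]; exists k.
split=> [_ [k xk <-] l kl|y yub k xk].
  by apply: (svalP x) => u xu; apply: kl; exact: xu.
by apply: (yub (cutK k)); first exists k.
Qed.

Lemma completion_meet_base x :
  exists2 A, A `<=` range cutO & is_meet completion_le A x.
Proof.
exists (cutO @` upper (sval x)); first by move=> _ [u _ <-]; exists u.
split=> [_ [u xu <-] k xk _ ->|y ylb k yk]; first exact: xu.
apply: (svalP x) => u xu.
by apply: (ylb (cutO u) _ k yk u erefl); exists u.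
Qed.

Definition completion_lattice : double_base_lattice :=
  DoubleBaseLattice completion_complete completion_join_base
    completion_meet_base.

End Completion.

(** * Essential surjectivity through the completion *)

Section CompletionObject.
Variable P : bicontinuous_bidcpo.

Lemma completion_bidcpo : is_embedded_bidcpo (completion_lattice P).
Proof.
exact: (@embedded_bidcpo_of_rep P (completion_lattice P) (@cutK P) (@cutO P)
  erefl erefl (@cut_rel P) (bb_bidcpo P)).
Qed.

Lemma completion_bicontinuous : embedded_bicontinuous (completion_lattice P).
Proof.
exact: (@embedded_bicontinuous_of_rep P (completion_lattice P) (@cutK P)
  (@cutO P) erefl erefl (@cut_rel P) (bb_bicontinuous P)).
Qed.

Definition completion_object : bicontinuous_embedded_bidcpo :=
  BicontinuousEmbeddedBidcpo completion_bidcpo completion_bicontinuous.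

(** The bases of the completion are the ranges of [cutK] and [cutO], so both maps onto them are
    surjective, and [cut_rel] says that they preserve and reflect the relation. *)
Lemma completion_iso :
  exists (f : galois_morphism (base_polarity (completion_lattice P)) P)
         (g : galois_morphism P (base_polarity (completion_lattice P))),
    gm_comp g f = gm_id _ /\ gm_comp f g = gm_id P.
Proof.
apply: (@surj_polarity_iso P (base_polarity (completion_lattice P))
  (fun k => exist _ (cutK k) (imageP _ Logic.I))
  (fun u => exist _ (cutO u) (imageP _ Logic.I))).
- exact: bd_purified (bb_bidcpo P).
- by move=> [x [k Tk kx]]; exists k; exact: exist_ext.
- by move=> [x [u Tu ux]]; exists u; exact: exist_ext.
- by move=> k u /=; split=> /cut_rel.
Qed.

End CompletionObject.

Lemma embedded_bidcpo_equivalence :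
  equivalent_categories bicontinuous_embedded_bidcpo_cat bicontinuous_bidcpo_cat.
Proof.
apply: (@equivalent_of_fully_faithful _ _ base_functor).
- by move=> L1 L2 g; exact: base_galois_surj.
- by move=> L1 L2 f g; exact: base_galois_inj.
- by move=> P; exists (completion_object P); exact: completion_iso.
Qed.

Theorem theorem6p9 :
  equivalent_categories continuous_domain_cat bicontinuous_bidcpo_cat /\
  equivalent_categories bicontinuous_bidcpo_cat
    bicontinuous_embedded_bidcpo_cat /\
  equivalent_categories continuous_domain_cat
    bicontinuous_embedded_bidcpo_cat.
Proof.
have eq12 := domain_bidcpo_equivalence.
have eq23 := equivalent_categories_sym embedded_bidcpo_equivalence.
by split; [|split] => //; exact: equivalent_categories_trans eq12 eq23.
Qed.
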